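(* Let $z\ge 1$ be an integer and let Algorithm SE-A (with parameter $z$) be run from a connected simple graph $\mathcal{G}_0$ containing at least one edge. Then Algorithm SE-A satisfies the str$\pi$ps probability scheme and generates a simple graph according to the definition of the Barabási--Albert model with $m=2$. That is: in every round, conditionally on the current graph $\mathcal{G}(V,E)$ at the start of the round, the pair selected to receive edges from the newborn vertex consists of exactly two distinct vertices of $V$, each vertex $x\in V$ of degree $d_x$ belongs to the selected pair with probability exactly $2\cdot d_x/\sum_{y\in V} d_y = d_x/|E|$, and the output graph is simple.
   Context: **Round of the BA model.** Given a graph of order at least $m$, $m$ distinct nodes are randomly selected from the vertex set, the probability of each node being present in the sample being exactly proportional to its degree; a new node is inserted and connected to each of the $m$ selected nodes. **str$\pi$ps.** A random sampling scheme selecting exactly $k$ distinct items out of $n$ items with weights $w_1,\dots,w_n$ satisfies the str$\pi$ps property if the inclusion probability of item $i$ equals $k\, w_i/\sum_j w_j$ for all $i$. **Random systematic sampling (RSS).** Input: distinct elements $x_1,\dots,x_N$ with positive integer frequencies $d_1,\dots,d_N$, $s=\sum_i d_i$, and a sample size $m$ dividing $s$ (here always $d_i\le s/m$). Permute the elements (together with their frequencies) uniformly at random; independently draw $r$ uniformly from $[0,s/m)$; with $D_i=d_1+\dots+d_i$ (in the permuted order, $D_0=0$), output for each $j=0,1,\dots,m-1$ the element $x_i$ for which $D_{i-1}\le r+j\,s/m<D_i$. **Algorithm SE-A** (parameter $z\ge1$, target order $n$). Start with $(V,E)=\mathcal{G}_0$. While $|V|<n$, perform a round: (1) select $z$ edges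 $e_1,\dots,e_z$ of $E$ independently and uniformly at random (with replacement); (2) form the bag of endpoints of these edges, in which each vertex has frequency equal to the number of indices $i$ such that $e_i$ contains it (total frequency $2z$), and apply RSS with sample size $m=2$ to get a pair $\{u,w\}$; (3) add a new vertex $v$ to $V$ and the edges $\{v,u\},\{v,w\}$ to $E$. Output $\mathcal{G}(V,E)$. *)

(* Defs.v *)
From HB Require Import structures.
From mathcomp Require Import all_boot all_order all_algebra.
From mathcomp Require Import finmap multiset.
From mathcomp Require Import all_classical all_reals all_analysis.

Set Implicit Arguments.
Unset Strict Implicit.
Unset Printing Implicit Defensive.

Import Order.TTheory GRing.Theory Num.Theory.
Import numFieldNormedType.Exports.

Local Open Scope classical_set_scope.
Local Open Scope ring_scope.

(* The edges form a multiset of vertex sets, so that parallel edges are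
   represented (multiplicity > 1), and so are loops (singletons); simplicity is
   a genuine property of a graph. *)
Record graph (K : choiceType) := Graph {
  vert : {fset K};
  edges : multiset {fset K} }.

Definition simple_graph (K : choiceType) (G : graph K) : Prop :=
  forall e : {fset K}, e \in edges G ->
    [/\ edges G e = 1%N, #|` e|%fset = 2%N & (e `<=` vert G)%fset].

Definition adjacent (K : choiceType) (G : graph K) : rel K :=
  fun x y => [fset x; y]%fset \in edges G.

Definition connected_graph (K : choiceType) (G : graph K) : Prop :=
  (exists x, x \in vert G) /\
  forall x y, x \in vert G -> y \in vert G ->
    exists2 p : seq K, path (adjacent G) x p & last x p = y.

(* Every edge containing x counts once; this is the usual degree as long as
   there are no loops. *)
Definition degree (K : choiceType) (G : graph K) (x : K) : nat :=
  count (fun e : {fset K} => x \in e) (edges G).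

Definition add_vertex (K : choiceType) (v : K) (S : seq K) (G : graph K) :
    graph K :=
  Graph (v |` vert G)%fset
        (msetD (edges G) (seq_mset [seq [fset v; u]%fset | u <- S])).

(* Systematic sampling for the elements listed in (already permuted) order by
   x, with frequencies d. *)
Section Systematic.
Variables (R : realType) (K : eqType).
Implicit Types (x : seq K) (d : K -> nat).

Definition cumul x d (i : nat) : nat := (\sum_(y <- take i x) d y)%N.

Definition rss_period x d (m : nat) : R :=
  (\sum_(y <- x) d y)%:R / m%:R.

Definition rss_hit x d (a : R) (y : K) : bool :=
  (cumul x d (index y x))%:R <= a < (cumul x d (index y x).+1)%:R.

(* One item is appended for each offset j, so repeated items are kept. *)
Definition rss x d (m : nat) (r : R) : seq K :=
  [seq y | j <- iota 0 m,
           y <- [seq y <- x | rss_hit x d (r + j%:R * rss_period x d m) y]].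

End Systematic.

Definition bag_elements (K : choiceType) (es : seq {fset K}) : {fset K} :=
  (\bigcup_(e <- es) e)%fset.

Definition bag_freq (K : choiceType) (es : seq {fset K}) (x : K) : nat :=
  count (fun e : {fset K} => x \in e) es.

Section Sampling.
Variables (dsp : measure_display) (Omega : measurableType dsp) (R : realType).
Variable P : probability Omega R.

Definition cprob (A B : set Omega) : R := fine (P (A `&` B)) / fine (P B).

(* S, conditionally on B, is a strpips sample of k items out of V with
   weights w. *)
Record strpips (K : choiceType) (B : set Omega) (V : {fset K}) (w : K -> R)
    (k : nat) (S : Omega -> seq K) : Prop := {
  strpips_distinct : forall omega, B omega ->
    [/\ uniq (S omega), size (S omega) = k & {subset S omega <= V}];
  strpips_measurable : forall x, x \in V ->
    measurable ([set omega | x \in S omega] `&` B);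
  strpips_inclusion : forall x, x \in V ->
    cprob [set omega | x \in S omega] B = k%:R * w x / \sum_(y <- V) w y }.

(* fresh V is the name given to a vertex inserted into a graph on V. *)
Record BA_process (K : choiceType) (fresh : {fset K} -> K) (m n : nat)
    (G0 : graph K) (G : nat -> Omega -> graph K)
    (S : nat -> Omega -> seq K) : Prop := {
  BA_init : forall omega, G 0%N omega = G0;
  BA_insert : forall t omega, (#|` vert (G t omega)|%fset < n)%N ->
    G t.+1 omega =
    add_vertex (fresh (vert (G t omega))) (S t omega) (G t omega);
  BA_select : forall t g, (#|` vert g|%fset < n)%N ->
    P [set omega | G t omega = g] != 0%E ->
    (m <= #|` vert g|%fset)%N /\
    strpips [set omega | G t omega = g] (vert g) (fun x => (degree g x)%:R) m
            (S t) }.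

End Sampling.

(* The randomness of round t: the z edges es t, the random ordering ord t of the
   distinct elements of their bag of endpoints, and the offset off t. *)
Section SEA.
Variables (dsp : measure_display) (Omega : measurableType dsp) (R : realType).
Variables (K : choiceType) (fresh : {fset K} -> K) (n : nat) (G0 : graph K).
Variables (es : nat -> Omega -> seq {fset K}) (ord : nat -> Omega -> seq K).
Variable off : nat -> Omega -> R.

Definition SEA_pair (t : nat) (omega : Omega) : seq K :=
  rss (ord t omega) (bag_freq (es t omega)) 2%N (off t omega).

Fixpoint SEA_graph (t : nat) (omega : Omega) : graph K :=
  if t is t'.+1 then
    let G := SEA_graph t' omega in
    if (#|` vert G|%fset < n)%N
    then add_vertex (fresh (vert G)) (SEA_pair t' omega) G
    else G
  else G0.

Definition SEA_halts (omega : Omega) (t : nat) : Prop :=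
  (n <= #|` vert (SEA_graph t omega)|%fset)%N /\
  forall i, (i < t)%N -> (#|` vert (SEA_graph i omega)|%fset < n)%N.

(* Sigma-algebra of the events determined by the rounds before round t. *)
Definition SEA_history (t : nat) : set (set Omega) :=
  <<s [set B | exists2 i, (i < t)%N &
        [\/ exists e, B = es i @^-1` [set e],
            exists p, B = ord i @^-1` [set p]
          | exists2 A : set R, measurable A & B = off i @^-1` A]] >>.

(* The law clause says that in a round, given the past and the current graph g,
   the edges are independent and uniform in the multiset edges g, the ordering
   is uniform among the N! orderings of the N distinct elements of the bag, and
   the offset is uniform and independent of the ordering. *)
Record SEA_run (z : nat) (P : probability Omega R) : Prop := {
  SEA_measurable_es : forall t e, measurable (es t @^-1` [set e]);
  SEA_measurable_ord : forall t p, measurable (ord t @^-1` [set p]);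
  SEA_measurable_off : forall t, measurable_fun setT (off t);
  SEA_support : forall t omega,
    (#|` vert (SEA_graph t omega)|%fset < n)%N ->
    [/\ size (es t omega) = z,
        {subset es t omega <= edges (SEA_graph t omega)},
        perm_eq (ord t omega) (bag_elements (es t omega))
      & 0 <= off t omega <
          rss_period R (ord t omega) (bag_freq (es t omega)) 2%N];
  SEA_law : forall t (H : set Omega) g (e : seq {fset K}) (p : seq K)
      (A : set R) (period_gt0 : 0 < rss_period R p (bag_freq e) 2%N),
    SEA_history t H -> (#|` vert g|%fset < n)%N -> size e = z ->
    perm_eq p (bag_elements e) -> measurable A ->
    P (H `&` [set omega | [/\ SEA_graph t omega = g, es t omega = e,
                              ord t omega = p & A (off t omega)]])
    = (P (H `&` [set omega | SEA_graph t omega = g])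
       * (\prod_(i <- e) ((edges g i)%:R / (size (edges g))%:R))%:E
       * ((#|` bag_elements e|%fset)`!%:R^-1)%:E
       * uniform_prob period_gt0 A)%E }.

End SEA.

(* Main.v *)
(* A bag of z edges of a simple graph has 2z endpoints, and no vertex occurs in
   it more than z times, so its systematic sampling period is z. The offsets r
   and r + z then fall in blocks of two distinct vertices, and a vertex of
   frequency f, whose block has length f <= z, is hit for a set of offsets r in
   [0, z) of measure f, that is, with probability f / z, whatever the ordering.
   Averaged over z independent uniform edges, f has mean z * deg x / |E|, which
   leaves deg x / |E|. Simplicity is preserved because each round joins a fresh
   vertex to two distinct old ones. *)

Require Import Defs.
From HB Require Import structures.
From mathcomp Require Import all_boot all_order all_algebra.
From mathcomp Require Import finmap multiset.
From mathcomp Require Import all_classical all_reals all_analysis.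
From mathcomp Require Import ring lra.

Set Implicit Arguments.
Unset Strict Implicit.
Unset Printing Implicit Defensive.

Import Order.TTheory GRing.Theory Num.Theory.
Import numFieldNormedType.Exports.

Local Open Scope classical_set_scope.
Local Open Scope ring_scope.

(** * Words of fixed length and double counting *)

Fixpoint words (T : Type) (s : seq T) (k : nat) : seq (seq T) :=
  if k is k'.+1 then [seq x :: w | x <- s, w <- words s k'] else [:: [::]].

Lemma size_words (T : Type) (s : seq T) k : size (words s k) = (size s ^ k)%N.
Proof. by elim: k => //= k IH; rewrite size_allpairs IH expnS. Qed.

Lemma mem_words (T : eqType) (s : seq T) k w :
  (w \in words s k) = (size w == k) && all (mem s) w.
Proof.
elim: k w => [|k IH] [|y w] //=.
  by apply/negbTE/allpairsP => -[[a b] []].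
rewrite eqSS; apply/allpairsP/andP => [[[a b]] /= [sa]|[wk /andP[sy sw]]].
  by rewrite IH => /andP[sb allb] [-> ->]; split => //; apply/andP.
by exists (y, w); split => //; rewrite IH wk sw.
Qed.

Lemma uniq_words (T : eqType) (s : seq T) k : uniq s -> uniq (words s k).
Proof.
move=> us; elim: k => //= k IH; apply: allpairs_uniq => //.
by move=> [a b] [c d] _ _ /= [-> ->].
Qed.

(** Each of the [k] positions contributes [count a s] once for every choice of the other [k.-1]
    letters. Divided by [size s ^ k], this is the mean frequency over [k] independent uniform
    draws. *)
Lemma sum_count_words (T : Type) (a : pred T) (s : seq T) k :
  (\sum_(w <- words s k) count a w = k * count a s * size s ^ k.-1)%N.
Proof.
elim: k => [|k IH] /=; first by rewrite big_seq1.
rewrite big_allpairs_dep /=.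
transitivity
  (\sum_(x <- s) (a x * size s ^ k + k * count a s * size s ^ k.-1))%N.
  by apply: eq_bigr => x _; rewrite big_split /= IH big_const_seq count_predT
    iter_addn_0 size_words.
rewrite big_split /= -big_distrl /= big_const_seq count_predT iter_addn_0.
rewrite mulSn mulnDl; congr (_ + _)%N.
  congr (_ * _)%N; rewrite -sum1_count [RHS]big_mkcond.
  by apply: eq_bigr => x _; case: (a x).
(* The exponent [k.-1] truncates at [k = 0], where the factor [k] kills both sides. *)
by case: k {IH} => [|k] //=; rewrite expnSr mulnA.
Qed.

(** Double counting of incidences. It gives both the handshake identity for degrees and the total
    frequency of a bag. *)
Lemma sum_count_fset (K : choiceType) (c : nat) (p : seq K)
    (es : seq {fset K}) :
  uniq p ->
  (forall e, e \in es -> #|` e|%fset = c /\ {subset e <= p}) ->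
  (\sum_(y <- p) count (fun e : {fset K} => y \in e) es = c * size es)%N.
Proof.
move=> up; elim: es => [|e es IH] es_p /=.
  by rewrite big1_eq muln0.
have [ce ep] := es_p e (mem_head _ _).
rewrite big_split /= IH => [|f fes]; last by apply: es_p; rewrite inE fes orbT.
rewrite mulnS; congr (_ + _)%N.
rewrite -big_mkcond sum1_count.
rewrite -size_filter -ce; apply/perm_size/uniq_perm; rewrite ?filter_uniq //.
by move=> y; rewrite mem_filter; case: (boolP (y \in e)) => // /ep.
Qed.

(** * Simple graphs: degree sum and vertex insertion *)

Lemma degree_sum (K : choiceType) (G : graph K) : simple_graph G ->
  (\sum_(y <- vert G) degree G y = 2 * size (edges G))%N.
Proof.
move=> sG; by apply: sum_count_fset => [|e /sG[_ -> /fsubsetP]].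
Qed.

Lemma degree_share (R : realType) (K : choiceType) (g : graph K) x :
  simple_graph g ->
  2 * (degree g x)%:R / \sum_(y <- vert g) (degree g y)%:R =
  (degree g x)%:R / (size (edges g))%:R :> R.
Proof.
by move=> sg; rewrite -natr_sum degree_sum // natrM invfM mulrACA mulfV ?mul1r.
Qed.

(** Ensures that a list of all words over [edges G] counts each edge draw once. *)
Lemma simple_graph_uniq (K : choiceType) (G : graph K) : simple_graph G ->
  uniq (edges G).
Proof.
move=> sG; apply: count_mem_uniq => e; rewrite count_mem_mset.
by case: (boolP (e \in edges G)) => [/sG[]//|/mset_eq0P].
Qed.

Lemma mem_bag_elements (K : choiceType) (es : seq {fset K}) x :
  (x \in bag_elements es) = has (fun e : {fset K} => x \in e) es.
Proof.
apply/bigfcupP/hasP => [[e]|[e]].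
  by rewrite andbT; exists e.
by exists e => //; rewrite andbT.
Qed.

(** Every new edge contains [v], so none coincides with an old edge, and [u] can be recovered from
    [[fset v; u]], so no two new edges coincide. *)
Lemma simple_add_vertex (K : choiceType) (G : graph K) (v : K) (S : seq K) :
  simple_graph G -> v \notin vert G -> uniq S -> {subset S <= vert G} ->
  simple_graph (add_vertex v S G).
Proof.
move=> sG vG uS SG.
have vS u : u \in S -> v != u.
  by move=> /SG uG; apply: contraNneq vG => ->.
have inj : {in S &, injective (fun u => [fset v; u]%fset)}.
  move=> a b aS bS /fsetP /(_ a); rewrite !inE eqxx orbT.
  by rewrite eq_sym (negbTE (vS _ aS)) /= => /esym /eqP.
have uS' : uniq [seq [fset v; u]%fset | u <- S] by rewrite map_inj_in_uniq.
move=> e; rewrite in_msetD msetE2 mset_seqE count_uniq_mem //=.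
have -> : (e \in seq_mset [seq [fset v; u]%fset | u <- S]) =
          (e \in [seq [fset v; u]%fset | u <- S]).
  by rewrite (perm_mem (perm_eq_seq_mset _)).
case: (boolP (e \in edges G)) => /= [eG _|eG].
  have [-> -> eV] := sG _ eG; split => //; last first.
    exact/(fsubset_trans eV)/fsubsetUr.
  suff -> : (e \in [seq [fset v; u]%fset | u <- S]) = false by [].
  apply: contraNF vG => /mapP[u _ ee]; apply: (fsubsetP eV).
  by rewrite ee !inE eqxx.
move=> eS; rewrite eS; split.
- by move: eG => /mset_eq0P ->.
- by move: eS => /mapP[u uu ->]; rewrite cardfs2 (vS _ uu).
- move: eS => /mapP[u /SG uu ->]; apply/fsubsetP => x; rewrite !inE.
  by move=> /orP[->//|/eqP ->]; rewrite uu orbT.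
Qed.

Lemma measurable_set_cst (d : measure_display) (T : measurableType d)
  (Q : Prop) : measurable [set _ : T | Q].
Proof.
have [q|q] := pselect Q.
  by rewrite (_ : [set _ | _] = setT) //; apply/seteqP; split.
by rewrite (_ : [set _ | _] = set0) //; apply/seteqP; split.
Qed.

(** * Systematic sampling of a pair *)

Section SystematicPair.
Variables (R : realType) (K : eqType).
Implicit Types (x : seq K) (d : K -> nat) (a r : R) (y : K).

(** Removing the head block shifts all later blocks left by [d y]; this drives the induction along
    the list. *)
Lemma rss_hit_cons x d a y y' : y' != y ->
  rss_hit (y :: x) d a y' = rss_hit x d (a - (d y)%:R) y'.
Proof.
move=> yy'; rewrite /rss_hit /cumul /= eq_sym (negbTE yy') /= !big_cons.
by rewrite !natrD lerBrDl ltrBlDl.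
Qed.

Lemma filter_rss_hit_cons x d a y : y \notin x ->
  [seq y' <- x | rss_hit (y :: x) d a y'] =
  [seq y' <- x | rss_hit x d (a - (d y)%:R) y'].
Proof.
move=> yx; apply: eq_in_filter => y' y'x.
by apply: rss_hit_cons; apply: contraNneq yx => <-.
Qed.

Lemma filter_rss_hit_lt0 x d a : a < 0 -> [seq y <- x | rss_hit x d a y] = [::].
Proof.
move=> a0; apply/eqP; rewrite -(negbK (_ == _)) -has_filter; apply/hasPn => y _.
by rewrite negb_and -ltNge (lt_le_trans a0 (ler0n _ _)).
Qed.

(** The half-open blocks tile the interval from 0 to the total frequency. *)
Lemma filter_rss_hit x d a : uniq x -> 0 <= a < (\sum_(y <- x) d y)%:R ->
  exists y, [seq y' <- x | rss_hit x d a y'] = [:: y].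
Proof.
elim: x a => [|y x IH] a /=; first by rewrite big_nil le_lt_asym.
move=> /andP[yx ux] /andP[a0]; rewrite big_cons natrD => aS.
rewrite filter_rss_hit_cons // {1}/rss_hit /cumul /= eqxx.
rewrite !take0 big_nil big_seq1 a0 /=; case: ltP => ady.
  (* The head block contains [a], so relative to the remaining blocks the point is negative and hits
     none. *)
  by rewrite filter_rss_hit_lt0 ?subr_lt0 //; exists y.
by apply: IH => //; rewrite subr_ge0 ady ltrBlDl.
Qed.

Lemma cumul_index_succ x d y : y \in x ->
  cumul x d (index y x).+1 = (cumul x d (index y x) + d y)%N.
Proof.
move=> yx; rewrite /cumul (take_nth y) ?index_mem // nth_index //.
by rewrite -cats1 big_cat big_seq1.
Qed.

Lemma cumul_le x d i : (cumul x d i <= \sum_(y <- x) d y)%N.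
Proof. by rewrite -{2}(cat_take_drop i x) big_cat leq_addr. Qed.

Lemma rss_two x d r : rss x d 2 r =
  [seq y <- x | rss_hit x d r y] ++
  [seq y <- x | rss_hit x d (r + rss_period R x d 2) y].
Proof. by rewrite /rss /= !map_id cats0 mul0r addr0 mul1r. Qed.

Lemma mem_rss_two x d r y : (y \in rss x d 2 r) =
  (y \in x) && (rss_hit x d r y || rss_hit x d (r + rss_period R x d 2) y).
Proof. by rewrite rss_two mem_cat !mem_filter -andb_orl andbC. Qed.

(** The total frequency is twice the period, so [r] and [r] plus the period each hit exactly one
    block; a half-open block no longer than the period cannot contain both. *)
Lemma rss_pair x d r : uniq x ->
  (forall y, y \in x -> (d y)%:R <= rss_period R x d 2) ->
  0 <= r < rss_period R x d 2 ->
  uniq (rss x d 2 r) /\ size (rss x d 2 r) = 2%N.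
Proof.
move=> ux dx /andP[r0 rq].
have sE : (\sum_(y <- x) d y)%:R = rss_period R x d 2 + rss_period R x d 2.
  by rewrite /rss_period -splitr.
have [u hu] : exists u, [seq y <- x | rss_hit x d r y] = [:: u].
  apply: filter_rss_hit => //; rewrite r0 sE; lra.
have [w hw] :
  exists w, [seq y <- x | rss_hit x d (r + rss_period R x d 2) y] = [:: w].
  apply: filter_rss_hit => //; rewrite sE; lra.
rewrite rss_two hu hw; split => //=; rewrite inE andbT.
have : u \in [:: u] by rewrite inE.
rewrite -hu mem_filter => /andP[/andP[cr _] xu].
apply/eqP => uw; have : w \in [:: w] by rewrite inE.
rewrite -hw mem_filter -uw => /andP[/andP[_]].
by rewrite cumul_index_succ // natrD; have := dx _ xu; lra.
Qed.

Lemma measurable_rss_hit x d (c : R) y :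
  measurable [set r : R | rss_hit x d (r + c) y].
Proof.
rewrite (_ : [set _ | _] = [set` `[(cumul x d (index y x))%:R - c,
    (cumul x d (index y x).+1)%:R - c[ ]); first exact: measurable_itv.
by apply/seteqP; split => r /=; rewrite /rss_hit in_itv /= lerBlDr ltrBrDr.
Qed.

(** Splitting on whether the head is kept turns [Q] into [Q \o cons t]. The tail [h] allows the
    lemma to be applied to one filter after another. *)
Lemma measurable_filter_cat (T : Type) (s : seq T) (b : R -> T -> bool)
    (h : R -> seq T) (Q : set (seq T)) :
  (forall t, measurable [set r : R | b r t]) ->
  (forall Q' : set (seq T), measurable [set r : R | Q' (h r)]) ->
  measurable [set r : R | Q (seq.filter (b r) s ++ h r)].
Proof.
move=> mb mh; elim: s Q => [|t s IH] Q /=; first exact: mh.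
rewrite (_ : [set _ | _] =
  ([set r | b r t] `&` [set r | (Q \o cons t) (seq.filter (b r) s ++ h r)]) `|`
  (~` [set r | b r t] `&` [set r | Q (seq.filter (b r) s ++ h r)])).
  apply: measurableU; apply: measurableI.
  - exact: mb.
  - exact: (IH (Q \o cons t)).
  - by apply: measurableC; exact: mb.
  - exact: IH.
apply/seteqP; split => r /=; case: (b r t) => /=; [by left|by right| |].
  by move=> [[]//|[]//].
by move=> [[]//|[]//].
Qed.

Lemma measurable_rss_two x d (Q : set (seq K)) :
  measurable [set r : R | Q (rss x d 2 r)].
Proof.
under eq_set do rewrite rss_two.
apply: measurable_filter_cat => [y|Q'].
  by have := measurable_rss_hit x d 0 y; under eq_set do rewrite addr0.
under eq_set do rewrite -[seq.filter _ _]cats0.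
apply: measurable_filter_cat => [y|Q'']; first exact: measurable_rss_hit.
exact: measurable_set_cst.
Qed.

Definition rss_offsets x d y : set R :=
  [set r | 0 <= r < rss_period R x d 2 /\ y \in rss x d 2 r].

Lemma measurable_rss_offsets x d y : measurable (rss_offsets x d y).
Proof.
rewrite (_ : rss_offsets x d y = [set` `[0, rss_period R x d 2[ ] `&`
  [set r | [set s : seq K | y \in s] (rss x d 2 r)]).
  by apply: measurableI; [exact: measurable_itv|exact: measurable_rss_two].
by apply/seteqP; split => r /=; rewrite in_itv.
Qed.

(** The maximum with 0 covers empty intervals, which occur when a block lies entirely on one side of
    [q]. *)
Lemma uniform_prob_itv (q u v : R) (q_gt0 : 0 < q) : 0 <= u -> v <= q ->
  uniform_prob q_gt0 [set` `[u, v[ ] = (Num.max 0 (v - u) / q)%:E.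
Proof.
move=> u0 vq; rewrite /uniform_prob.
rewrite (eq_integral (fun=> (q^-1)%:E)); last first.
  move=> r; rewrite inE /= in_itv /= => /andP[ur rv].
  by rewrite /uniform_pdf (le_trans u0 ur) (ltW (lt_le_trans rv vq)) subr0.
rewrite integral_cst //= lebesgue_measure_itv /= lte_fin -EFinD mulrC.
by case: ltP => uv; rewrite -EFinM; congr ((_ * _)%:E); apply/esym;
  [apply/max_idPr|apply/max_idPl]; lra.
Qed.

(* The lengths of [c, c + e) `&` [0, q) and of ([c, c + e) - q) `&` [0, q) add
   up to e. *)
Lemma clamp_length (q c e : R) : 0 <= c -> 0 <= e <= q -> c + e <= q + q ->
  Num.max 0 (Num.min q (c + e) - c) +
  Num.max 0 (c + e - q - Num.max 0 (c - q)) = e.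
Proof.
move=> c0 /andP[e0 eq] ceq.
have [qc|cq] := leP q c.
  rewrite min_l; last lra.
  rewrite (max_r (_ : 0 <= c - q)); last lra.
  by rewrite max_l ?max_r; lra.
rewrite (max_l (_ : c - q <= 0)) ?subr0; last lra.
rewrite [X in X + _]max_r; last by case: (leP q (c + e)); lra.
by have [ceq'|ceq'] := leP q (c + e); [rewrite max_r|rewrite max_l]; lra.
Qed.

(** The selecting offsets form two pieces of total length [d y], wherever the block of [y] starts;
    hence the value does not depend on the ordering. *)
Lemma uniform_prob_rss x d y (q_gt0 : 0 < rss_period R x d 2) : uniq x ->
  (d y)%:R <= rss_period R x d 2 -> (y \notin x -> d y = 0%N) ->
  uniform_prob q_gt0 (rss_offsets x d y) =
  ((d y)%:R / rss_period R x d 2)%:E.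
Proof.
rewrite /rss_offsets => ux dq.
have [yx _|yx ->//] := boolP (y \in x); last first.
  rewrite mul0r (_ : [set _ | _] = set0) ?measure0 //.
  by apply/seteqP; split => r //= []; rewrite mem_rss_two (negbTE yx).
set q := rss_period R x d 2 in q_gt0 dq *.
set c : R := (cumul x d (index y x))%:R.
have c0 : 0 <= c by rewrite ler0n.
have c's : c + (d y)%:R <= q + q.
  rewrite /q /rss_period -splitr -natrD -cumul_index_succ //.
  by rewrite ler_nat cumul_le.
have d0 : 0 <= (d y)%:R :> R by rewrite ler0n.
set e : R := (d y)%:R in dq c's d0 *.
(* The first piece is the block cut at [q]; the second is the block translated by [- q] and cut at
   0. *)
have -> : [set r | 0 <= r < q /\ y \in rss x d 2 r] =
    [set` `[c, Num.min q (c + e)[ ] `|` [set` `[Num.max 0 (c - q), c + e - q[ ].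
  apply/seteqP; split => r /=; rewrite !in_itv /= mem_rss_two yx /=
    /rss_hit cumul_index_succ // natrD -/c -/e -/q.
    move=> [/andP[r0 rq]] /orP[/andP[-> h]|/andP[h1 h2]].
      by left; rewrite lt_min rq h.
    by right; rewrite ge_max r0 /=; apply/andP; split; lra.
  move=> [/andP[h1]|/andP[]]; rewrite ?lt_min ?ge_max => /andP[h2 h3].
    by split; [|rewrite h1 h3]; lra.
  by move=> h4; split; [|apply/orP; right; apply/andP; split]; lra.
(* A common point would put [r] and [r + q] in one block of length [e <= q]. *)
have disj : [set` `[c, Num.min q (c + e)[ ] `&`
    [set` `[Num.max 0 (c - q), c + e - q[ ] = set0.
  apply/seteqP; split => r //=; rewrite !in_itv /= lt_min ge_max.
  by move=> [] /andP[? /andP[? ?]] /andP[/andP[? ?] ?]; lra.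
rewrite (measureU (uniform_prob q_gt0)
  (measurable_itv _) (measurable_itv _) disj).
have u2 : 0 <= Num.max 0 (c - q) by rewrite le_max lexx.
have v1 : Num.min q (c + e) <= q by rewrite ge_min lexx.
have v2 : c + e - q <= q by lra.
transitivity ((Num.max 0 (Num.min q (c + e) - c) / q)%:E +
  (Num.max 0 (c + e - q - Num.max 0 (c - q)) / q)%:E)%E.
  by congr (_ + _)%E; apply: uniform_prob_itv.
by rewrite -EFinD -mulrDl clamp_length // d0.
Qed.

End SystematicPair.

(** * Bags of endpoints *)

Lemma bag_elements_sub (K : choiceType) (G : graph K) (es : seq {fset K}) :
  simple_graph G -> {subset es <= edges G} ->
  {subset bag_elements es <= vert G}.
Proof.
move=> sG esG y; rewrite mem_bag_elements => /hasP[e /esG eG ye].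
by have [_ _ /fsubsetP] := sG _ eG; apply.
Qed.

Lemma rss_period_bag (R : realType) (K : choiceType) (es : seq {fset K})
    (p : seq K) :
  (forall e, e \in es -> #|` e|%fset = 2%N) -> perm_eq p (bag_elements es) ->
  rss_period R p (bag_freq es) 2 = (size es)%:R.
Proof.
move=> es2 pes; rewrite /rss_period (sum_count_fset (c := 2)).
- by rewrite natrM mulrC mulKf // pnatr_eq0.
- by rewrite (perm_uniq pes) fset_uniq.
- move=> e ees; split; first exact: es2.
  move=> y ye; rewrite (perm_mem pes) mem_bag_elements.
  by apply/hasP; exists e.
Qed.

Lemma bag_freq_eq0 (K : choiceType) (es : seq {fset K}) (p : seq K) x :
  perm_eq p (bag_elements es) -> x \notin p -> bag_freq es x = 0%N.
Proof.
move=> /perm_mem ->; rewrite mem_bag_elements has_count -eqn0Ngt.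
by move=> /eqP.
Qed.

(** * Pathwise properties of a run: distinct pairs, simplicity, halting *)

Section Run.
Variables (R : realType) (dsp : measure_display) (Omega : measurableType dsp).
Variable P : probability Omega R.
Variables (K : choiceType) (fresh : {fset K} -> K).
Hypothesis fresh_notin : forall V : {fset K}, fresh V \notin V.
Variables (z n : nat) (G0 : graph K).
Hypothesis G0_simple : simple_graph G0.
Variables (es : nat -> Omega -> seq {fset K}) (ord : nat -> Omega -> seq K).
Variable off : nat -> Omega -> R.
Hypothesis run : SEA_run fresh n G0 es ord off z P.

Local Notation G := (SEA_graph fresh n G0 es ord off).
Local Notation S := (SEA_pair es ord off).

(** A frequency is at most the number of drawn edges, which is the period, so [rss_pair] applies.
    Simplicity is a premise here because its own induction rests on this fact. *)
Lemma SEA_pair_distinct t omega : simple_graph (G t omega) ->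
  (#|` vert (G t omega)|%fset < n)%N ->
  [/\ uniq (S t omega), size (S t omega) = 2%N
    & {subset S t omega <= vert (G t omega)}].
Proof.
move=> sG Gn; have [_ esG op offp] := SEA_support run Gn.
have up : uniq (ord t omega) by rewrite (perm_uniq op) fset_uniq.
have [|uS sS] := rss_pair up _ offp.
  move=> y _; rewrite rss_period_bag // => [|e /esG /sG[]//].
  by rewrite ler_nat count_size.
split => // y; rewrite /SEA_pair mem_rss_two (perm_mem op) => /andP[+ _].
exact: (bag_elements_sub sG).
Qed.

Lemma SEA_simple t omega : simple_graph (G t omega).
Proof.
elim: t => [|t IH] //=; case: ifP => // Gn.
by have [uS _ SG] := SEA_pair_distinct IH Gn; apply: simple_add_vertex.
Qed.

Lemma SEA_card_vert t omega : (#|` vert (G t omega)|%fset < n)%N ->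
  #|` vert (G t.+1 omega)|%fset = #|` vert (G t omega)|%fset.+1.
Proof. by move=> /= ->; rewrite cardfsU1 fresh_notin. Qed.

(** The order grows by one in each active round, so some round reaches [n]; the least such round is
    the halting time. *)
Lemma SEA_halting omega : exists t, SEA_halts fresh n G0 es ord off omega t.
Proof.
have ex : exists t, (n <= #|` vert (G t omega)|%fset)%N.
  apply: contrapT => nex.
  have lt_n t : (#|` vert (G t omega)|%fset < n)%N.
    by rewrite ltnNge; apply/negP => le_n; apply: nex; exists t.
  suff le_t t : (t <= #|` vert (G t omega)|%fset)%N by apply: nex; exists n.
  by elim: t => // t IH; rewrite SEA_card_vert.
case: (ex_minnP ex) => t le_n min_t; exists t; split => // i it.
by rewrite ltnNge; apply: contraL it => /min_t; rewrite -leqNgt.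
Qed.

(** * Finitely many outcomes and measurability *)

Lemma finite_range_SEA t : finite_set (range (G t)).
Proof.
elim: t => [|t IH].
  by apply: (@sub_finite_set _ _ [set G0]) => // _ [omega _ <-].
(* A finite superset of the successors of [g]: the selected pair is a word of length 2 over its
   vertices. *)
pose step g := [set g] `|`
  [set add_vertex (fresh (vert g)) s g | s in [set` words (vert g) 2]].
apply: (@sub_finite_set _ _ (\bigcup_(g in range (G t)) step g)).
  move=> _ [omega _ <-]; exists (G t omega); first by exists omega.
  rewrite /step /=; case: ifP => Gn; last by left.
  have [_ sS SG] := SEA_pair_distinct (@SEA_simple t omega) Gn.
  have Sw : S t omega \in words (vert (G t omega)) 2.
    by rewrite mem_words sS eqxx; apply/allP.
  by right; exists (S t omega).
apply: bigcup_finite => // g _; rewrite finite_setU; split => //.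
exact/finite_image/finite_seq.
Qed.

(** The discrete outcomes of a round started from [g]: the drawn edges, then an ordering of their
    bag. *)
Definition samples (g : graph K) : seq (seq {fset K} * seq K) :=
  [seq (e, p) | e <- words (edges g) z, p <- permutations (bag_elements e)].

Lemma samples_uniq g : simple_graph g -> uniq (samples g).
Proof.
move=> /simple_graph_uniq ug; apply: allpairs_uniq_dep.
- exact: uniq_words.
- by move=> e _; exact: permutations_uniq.
- by move=> [a b] [c d] /= _ _ [-> ->].
Qed.

Lemma mem_samples g e p : ((e, p) \in samples g) =
  [&& size e == z, all (mem (edges g)) e & perm_eq p (bag_elements e)].
Proof.
apply/allpairsPdep/and3P => [[e' [p' [+ + [-> ->]]]]|[sz eg pe]].
  by rewrite mem_words mem_permutations => /andP[].
by exists e, p; rewrite mem_words mem_permutations sz.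
Qed.

Lemma SEA_samples t omega : (#|` vert (G t omega)|%fset < n)%N ->
  (es t omega, ord t omega) \in samples (G t omega).
Proof.
move=> Gn; have [sz esG op _] := SEA_support run Gn.
by rewrite mem_samples sz eqxx op andbT /=; apply/allP.
Qed.

(** The set of offsets may vary with [ep], because the layout of the blocks does. *)
Definition cell t g (A : seq {fset K} * seq K -> set R) ep : set Omega :=
  [set omega | [/\ G t omega = g, es t omega = ep.1, ord t omega = ep.2
                 & A ep (off t omega)]].

Lemma measurable_cell t g A ep : measurable [set omega | G t omega = g] ->
  measurable (A ep) -> measurable (cell t g A ep).
Proof.
move=> mg mA; rewrite (_ : cell _ _ _ _ = [set omega | G t omega = g] `&`
  (es t @^-1` [set ep.1] `&` (ord t @^-1` [set ep.2] `&` off t @^-1` A ep))).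
  apply: measurableI => //; apply: measurableI.
    exact: (SEA_measurable_es run).
  apply: measurableI; first exact: (SEA_measurable_ord run).
  by rewrite -[_ @^-1` _]setTI; exact: (SEA_measurable_off run).
by apply/seteqP; split => omega /= [? [? [? ?]]] //; split.
Qed.

Lemma bigcup_cell t g (A : seq {fset K} * seq K -> set R) :
  (#|` vert g|%fset < n)%N ->
  [set omega | G t omega = g /\ A (es t omega, ord t omega) (off t omega)] =
  \bigcup_(ep in [set` samples g]) cell t g A ep.
Proof.
move=> gn; apply/seteqP; split => omega /=.
  move=> [Gg Ao]; exists (es t omega, ord t omega) => //.
  by rewrite /= -Gg; apply: SEA_samples; rewrite Gg.
by move=> [[e p] _ [-> -> -> Ao]].
Qed.

Lemma measurable_SEA_pair t g (Q : set (seq K)) :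
  measurable [set omega | G t omega = g] -> (#|` vert g|%fset < n)%N ->
  measurable [set omega | G t omega = g /\ Q (S t omega)].
Proof.
move=> mg gn.
pose A (ep : seq {fset K} * seq K) :=
  [set r : R | Q (rss ep.2 (bag_freq ep.1) 2 r)].
rewrite (bigcup_cell t A gn).
apply: fin_bigcup_measurable; first exact: finite_seq.
by move=> ep _; apply: measurable_cell => //; exact: measurable_rss_two.
Qed.

(** Induction on [t]: split over the finitely many previous graphs; given one of them, the next
    graph is a function of the selected pair. *)
Lemma measurable_SEA_graph t g : measurable [set omega | G t omega = g].
Proof.
elim: t g => [|t IH] g.
  exact: (@measurable_set_cst _ _ (G0 = g)).
rewrite (_ : [set _ | _] =
  \bigcup_(h in range (G t)) [set omega | G t omega = h /\ G t.+1 omega = g]).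
  apply: fin_bigcup_measurable; first exact: finite_range_SEA.
  move=> h _; have [hn|hn] := boolP (#|` vert h|%fset < n)%N.
    rewrite (_ : [set _ | _] = [set omega | G t omega = h /\
        [set s | add_vertex (fresh (vert h)) s h = g] (S t omega)]).
      exact: measurable_SEA_pair.
    by apply/seteqP; split => omega /= [Gh]; rewrite Gh hn.
  rewrite (_ : [set _ | _] = [set omega | G t omega = h] `&` [set _ | h = g]).
    by apply: measurableI => //; exact: measurable_set_cst.
  by apply/seteqP; split => omega /= [Gh]; rewrite Gh (negbTE hn).
apply/seteqP; split => omega; last by move=> [h _ []].
by move=> Gg; exists (G t omega) => //; exists omega.
Qed.

(** * The inclusion probability *)

Lemma prob_cell t g x e p : simple_graph g -> (0 < z)%N ->
  (#|` vert g|%fset < n)%N -> (e, p) \in samples g ->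
  P (cell t g (fun ep => rss_offsets ep.2 (bag_freq ep.1) x) (e, p)) =
  (P [set omega | G t omega = g] *
   ((size (edges g))%:R^-1 ^+ z * (#|` bag_elements e|%fset)`!%:R^-1 *
    ((bag_freq e x)%:R / z%:R))%:E)%E.
Proof.
move=> sg z0 gn; rewrite mem_samples => /and3P[/eqP sz /allP eg pe].
have qE : rss_period R p (bag_freq e) 2 = z%:R.
  by rewrite rss_period_bag ?sz // => f /eg /sg[].
have q0 : 0 < rss_period R p (bag_freq e) 2 by rewrite qE ltr0n.
have mA := @measurable_rss_offsets R _ p (bag_freq e) x.
(* With the trivial past event, the law clause conditions on the current graph alone. *)
have hT : SEA_history es ord off t setT.
  exact: (@measurableT _ (g_sigma_algebraType _)).
have := SEA_law run q0 hT gn sz pe mA; rewrite !setTI => ->.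
rewrite uniform_prob_rss; last exact: bag_freq_eq0.
- rewrite -!muleA; congr (_ * _)%E; rewrite -!EFinM qE mulrA.
  congr ((_ * _ * _)%:E).
  (* Each drawn edge has multiplicity 1, so its factor is the inverse of the number of edges. *)
  rewrite (eq_big_seq (fun=> (size (edges g))%:R^-1)) => [|i /eg /sg[-> _ _]].
    by rewrite big_const_seq count_predT iter_mulr_1 sz.
  by rewrite mul1r.
- by rewrite (perm_uniq pe) fset_uniq.
- by rewrite qE ler_nat -sz count_size.
Qed.

(** Sum over the cells: orderings of a bag contribute equally and cancel the factorial, and
    [sum_count_words] averages the frequency over the edge draws. *)
Lemma SEA_inclusion t g x : simple_graph g -> (0 < z)%N ->
  (0 < size (edges g))%N -> (#|` vert g|%fset < n)%N ->
  P ([set omega | x \in S t omega] `&` [set omega | G t omega = g]) =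
  (P [set omega | G t omega = g] *
   ((degree g x)%:R / (size (edges g))%:R)%:E)%E.
Proof.
move=> sg z0 E0 gn.
pose A (ep : seq {fset K} * seq K) : set R :=
  rss_offsets ep.2 (bag_freq ep.1) x.
rewrite (_ : _ `&` _ =
  \bigcup_(ep in [set` samples g]) cell t g A ep); last first.
  rewrite -bigcup_cell //; apply/seteqP; split => omega /= [].
    move=> xS Gg; split => //; split => //.
    (* The support clause supplies the offset range built into [rss_offsets]. *)
    by have [] := SEA_support run (_ : (#|` vert (G t omega)|%fset < n)%N);
      rewrite ?Gg.
  by move=> Gg [].
rewrite measure_fin_bigcup //=; last 2 first.
- by move=> [e p] [e' p'] _ _ [omega [[/= _ <- <- _] [/= _ -> -> _]]].
- move=> ep _; apply: measurable_cell;
    [exact: measurable_SEA_graph|exact: measurable_rss_offsets].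
rewrite -fsbig_seq ?samples_uniq //.
rewrite (eq_big_seq (fun ep => (P [set omega | G t omega = g] *
   ((size (edges g))%:R^-1 ^+ z * (#|` bag_elements ep.1|%fset)`!%:R^-1 *
    ((bag_freq ep.1 x)%:R / z%:R))%:E)%E)) => [|[e p]]; last exact: prob_cell.
rewrite -ge0_sume_distrr; last first.
  by move=> ep _; rewrite lee_fin !mulr_ge0 ?exprn_ge0 ?invr_ge0.
congr (_ * _)%E; rewrite sumEFin; congr (_%:E).
rewrite big_allpairs_dep /=.
(* The summand ignores the ordering, so the inner sum is multiplication by the number of
   permutations. *)
under eq_bigr => e _.
  rewrite big_const_seq count_predT iter_addr_0 size_permutations //.
  rewrite -(mulr_natr (_ * _ * _)) mulrAC mulfVK ?pnatr_eq0 -?lt0n ?fact_gt0 //.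
  over.
rewrite /= -mulr_sumr -mulr_suml -natr_sum sum_count_words.
(* Writing [z] as a successor exposes the power [z.-1] that comes from the word count. *)
rewrite !natrM natrX exprVn -{1}(prednK z0) exprS.
have zn : z%:R != 0 :> R by rewrite pnatr_eq0 -lt0n.
have En : (size (edges g))%:R != 0 :> R by rewrite pnatr_eq0 -lt0n.
have EXn : (size (edges g))%:R ^+ z.-1 != 0 :> R by rewrite expf_neq0.
by rewrite /degree; field; rewrite zn En EXn.
Qed.

(** A non-null event contains some outcome, and at that outcome the pathwise facts apply: its pair
    exhibits two vertices, its first drawn edge an edge. *)
Lemma SEA_nonnull t g : (#|` vert g|%fset < n)%N -> (0 < z)%N ->
  P [set omega | G t omega = g] != 0%E ->
  [/\ (2 <= #|` vert g|%fset)%N, simple_graph g & (0 < size (edges g))%N].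
Proof.
move=> gn z0 Pg; have [omega Gg] : [set omega | G t omega = g] !=set0.
  by apply/set0P; apply: contra_neq Pg => ->; rewrite measure0.
have sg : simple_graph g by rewrite -Gg; exact: SEA_simple.
rewrite -Gg in gn sg *; split=> //.
  have [uS <- SG] := SEA_pair_distinct sg gn.
  exact: uniq_leq_size uS SG.
have [sz esG _ _] := SEA_support run gn.
case: (es t omega) sz esG => [sz|e s _ esG]; first by rewrite -sz in z0.
by rewrite -has_predT; apply/hasP; exists e => //; apply: esG; exact: mem_head.
Qed.

Lemma SEA_cprob t g x : (#|` vert g|%fset < n)%N -> (0 < z)%N ->
  P [set omega | G t omega = g] != 0%E ->
  cprob P [set omega | x \in S t omega] [set omega | G t omega = g] =
  (degree g x)%:R / (size (edges g))%:R.
Proof.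
move=> gn z0 Pg; have [_ sg E0] := SEA_nonnull gn z0 Pg.
rewrite /cprob SEA_inclusion //.
have mg := measurable_SEA_graph t g.
have Pfin := fin_num_measure P _ mg.
rewrite fineM // mulrAC mulfV ?mul1r //.
by rewrite fine_eq0.
Qed.

End Run.

Theorem theorem5
  (R : realType) (dsp : measure_display) (Omega : measurableType dsp)
  (P : probability Omega R)
  (K : choiceType) (fresh : {fset K} -> K)
  (fresh_notin : forall V : {fset K}, fresh V \notin V)
  (z n : nat) (z_ge1 : (1 <= z)%N)
  (G0 : graph K) (G0_simple : simple_graph G0)
  (G0_connected : connected_graph G0) (G0_edge : exists e, e \in edges G0)
  (es : nat -> Omega -> seq {fset K}) (ord : nat -> Omega -> seq K)
  (off : nat -> Omega -> R)
  (run : SEA_run fresh n G0 es ord off z P) :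
  let G := SEA_graph fresh n G0 es ord off in
  let S := SEA_pair es ord off in
  [/\ BA_process P fresh 2%N n G0 G S,
      (forall t omega, (#|` vert (G t omega)|%fset < n)%N ->
        [/\ uniq (S t omega), size (S t omega) = 2%N
          & {subset S t omega <= vert (G t omega)}]),
      (forall t g, (#|` vert g|%fset < n)%N ->
        P [set omega | G t omega = g] != 0%E ->
        forall x, x \in vert g ->
        cprob P [set omega | x \in S t omega] [set omega | G t omega = g]
          = 2 * (degree g x)%:R / \sum_(y <- vert g) (degree g y)%:R
        /\ 2 * (degree g x)%:R / \sum_(y <- vert g) (degree g y)%:R
          = (degree g x)%:R / (size (edges g))%:R :> R)
    & (forall omega, exists t,
        SEA_halts fresh n G0 es ord off omega t /\ simple_graph (G t omega))].
Proof.
move=> G S.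
have simple t omega : simple_graph (G t omega).
  exact: (SEA_simple fresh_notin G0_simple run).
have distinct t omega : (#|` vert (G t omega)|%fset < n)%N ->
    [/\ uniq (S t omega), size (S t omega) = 2%N
      & {subset S t omega <= vert (G t omega)}].
  exact: (SEA_pair_distinct run).
have nonnull := SEA_nonnull fresh_notin G0_simple run.
have inclusion t g x gn Pg :=
  SEA_cprob fresh_notin G0_simple run (t := t) (g := g) x gn z_ge1 Pg.
split => //; last first.
- move=> omega;
  have [t halt_t] := SEA_halting fresh_notin n G0 es ord off omega.
  by exists t; split.
- move=> t g gn Pg x xg; have [_ sg _] := nonnull _ _ gn z_ge1 Pg.
  (* The handshake identity turns the strpips ratio into degree over number of edges, the form
     computed from the cells. *)
  by split; rewrite degree_share //; exact: inclusion.
split => // [t omega /= ->//|t g gn Pg].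
have [card_g sg _] := nonnull _ _ gn z_ge1 Pg.
split => //; split => [omega Gg|x xg|x xg].
- rewrite -Gg; apply: distinct; rewrite Gg //.
- rewrite setIC.
  have mg := measurable_SEA_graph fresh_notin G0_simple run t g.
  exact: (measurable_SEA_pair run [set s : seq K | x \in s] mg gn).
- by rewrite degree_share //; exact: inclusion.
Qed.
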